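(* Let $M$ be a compact connected Kähler manifold with the Toeplitz quantization data of the context, and let $V,W$ be smooth vector bundles over $M$ with connections. Any morphism $\phi:V\to W$ of bundles with connections induces a homomorphism $\mathcal{Q}(\phi):\mathbb{V}\to\mathbb{W}$ of $\mathbb{A}$-modules which satisfies $$T^W\circ\phi=\mathcal{Q}(\phi)\circ T^V .$$
   Context: Setting. $M$ is a compact connected Kähler manifold with Kähler metric $g$ and symplectic form $\omega$. $L$ is a Hermitian line bundle on $M$ with a connection of curvature $\nabla^2=-i\omega$. $L_0$ is a holomorphic line bundle with an inner product on its sections (a pre-Hilbert structure on $\Gamma(M,L_0)$). Connections and inner products are assumed compatible. For $N\in\mathbb{N}=\{1,2,\dots\}$, $L_N:=L_0\otimes L^{\otimes N}$; the inner products on sections of $L_0$ and on fibers of $L$ combine to give an inner product on sections of $L_N$. $L_1$ is assumed positive. $\mathcal{H}_N:=\Gamma_{\mathrm{hol}}(M,L_N)$ is the space of holomorphic sections of $L_N$ (a finite-dimensional Hilbert space with this inner product), $\mathcal{A}_N:=\mathrm{End}\,\mathcal{H}_N$, and $\Pi_N$ is the self-adjoint projection of the Hilbert space of $(0,* )$-forms with coefficients in $L_N$ onto $\mathcal{H}_N$. $T_N:C(M)\to\mathcal{A}_N$ is $T_N(f)\varphi=\Pi_N(f\varphi)$. Algebra. $T:C(M)\to\prod_{N}\mathcal{A}_N$ ($C^*$-algebraic direct product) is the direct product of the $T_N$; $\mathbb{A}_0:=\bigoplus_N\mathcal{A}_N$ is the $C^*$-algebraic direct sum; $\mathbb{A}:=\operatorname{Im}T+\mathbb{A}_0$,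 which is a $C^*$-algebra. Bundles. For a smooth vector bundle $V$ with a connection, $D_V=\nabla_{\bar\partial}+(\nabla_{\bar\partial})^*=i\gamma^\mu\nabla_\mu$ is the $V^*\otimes L_N$-twisted Dolbeault operator acting on the smooth forms $\Omega^{0,*}(M,V^*\otimes L_N)$, where $\nabla$ is the connection and the Dirac matrices satisfy $\gamma^\mu\gamma^\nu+\gamma^\nu\gamma^\mu=g^{\mu\nu}$. $\tilde V_N:=\mathrm{Hom}(\ker D_V,\mathcal{H}_N)$, an $\mathcal{A}_N$-module. $\Gamma(M,V)$ is the space of continuous sections of $V$, and $T_N^V:\Gamma(M,V)\to\tilde V_N$ is $T_N^V(v)\psi=\Pi_N(v\psi)$ (contracting $V$ with $V^*$). $T^V:\Gamma(M,V)\to\prod_N\tilde V_N$ is the direct product of the $T_N^V$, and $\mathbb{V}:=\mathbb{A}\cdot\operatorname{Im}T^V$ is the $\mathbb{A}$-module generated by $\operatorname{Im}T^V$; $T^W$ and $\mathbb{W}$ are defined in the same way from $W$. A morphism of bundles with connections $\phi:V\to W$ is a smooth bundle homomorphism such that $\phi(\nabla_V v)=\nabla_W\phi(v)$ for every smooth section $v$ of $V$ (i.e. $\phi$ is covariantly constant); $\phi$ also denotes the induced maps of sections and of sections of tensor products with other bundles. *)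

(* Defs.v *)
From HB Require Import structures.
From mathcomp Require Import all_boot all_order all_algebra complex.
From mathcomp Require Import all_classical all_reals all_analysis.
Set Implicit Arguments.
Unset Strict Implicit.
Unset Printing Implicit Defensive.
Import Order.TTheory GRing.Theory Num.Theory.
Import numFieldNormedType.Exports.
Local Open Scope classical_set_scope.
Local Open Scope ring_scope.

Section RealCalculus.
Variables (R : realType) (E : normedModType R).
Implicit Types (F G : E -> R) (v z : E) (O : set E).

(* C^k through iterated directional derivatives. *)
Fixpoint smooth_upto (k : nat) O F : Prop :=
  (forall z, O z -> {for z, continuous F}) /\
  if k is k'.+1 then
    forall v, (forall z, O z -> derivable F z v) /\
              smooth_upto k' O (fun z => 'D_v F z)
  else True.

Definition smooth O F := forall k, smooth_upto k O F.

Lemma near_open O F G z : open O -> O z -> (forall w, O w -> F w = G w) ->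
  \near z, F z = G z.
Proof.
move=> oO Oz FG; near=> w; apply: FG; near: w; exact: open_nbhs_nbhs.
Unshelve. all: by end_near. Qed.

Lemma cont_ext (T : topologicalType) (f g : T -> R) (z : T) : f z = g z ->
  (\near z, f z = g z) -> {for z, continuous f} -> {for z, continuous g}.
Proof.
move=> fg e cf; have : f @ z --> f z by [].
by rewrite fg => h; apply: cvg_trans h; exact: near_eq_cvg.
Qed.

Lemma smooth_upto_ext k O F G : open O -> (forall w, O w -> F w = G w) ->
  smooth_upto k O F -> smooth_upto k O G.
Proof.
move=> oO; elim: k F G => [|k IH] F G FG /= [cF dF]; split=> //.
- by move=> z Oz; apply: cont_ext (cF z Oz); [exact: FG|exact: near_open FG].
- by move=> z Oz; apply: cont_ext (cF z Oz); [exact: FG|exact: near_open FG].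
- move=> v; have [dFv sF] := dF v; split.
    move=> z Oz; have e := near_open oO Oz FG.
    have [->|v0] := eqVneq v 0; first exact: derivable0.
    by apply: near_eq_derivable (dFv z Oz).
  apply: IH sF => z Oz; have e := near_open oO Oz FG.
  have [->|v0] := eqVneq v 0; first by rewrite !derive0.
  exact: near_eq_derive.
Qed.

Lemma smooth_uptoS k O F : smooth_upto k.+1 O F -> smooth_upto k O F.
Proof.
elim: k F => [|k IH] F; first by case.
move=> [cF dF]; split=> // v; have [dFv sF] := dF v; split=> //.
exact: IH.
Qed.

Lemma smooth_uptoD k O F G : open O -> smooth_upto k O F -> smooth_upto k O G ->
  smooth_upto k O (fun z => F z + G z).
Proof.
move=> oO; elim: k F G => [|k IH] F G /= [cF dF] [cG dG].
  by split=> // z Oz; apply: cvgD; [exact: cF|exact: cG].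
split=> [z Oz|v]; first by apply: cvgD; [exact: cF|exact: cG].
have [dFv sF] := dF v; have [dGv sG] := dG v.
split=> [z Oz|]; first by apply: derivableD; [exact: dFv|exact: dGv].
apply: (@smooth_upto_ext k O (fun z => 'D_v F z + 'D_v G z)) => //.
  by move=> z Oz; rewrite -deriveD //; [exact: dFv|exact: dGv].
exact: IH.
Qed.

Lemma smooth_uptoM k O F G : open O -> smooth_upto k O F -> smooth_upto k O G ->
  smooth_upto k O (fun z => F z * G z).
Proof.
move=> oO; elim: k F G => [|k IH] F G.
  move=> /= [cF dF] [cG dG].
  by split=> // z Oz; apply: cvgM; [exact: cF|exact: cG].
move=> sF0 sG0; have sF1 := smooth_uptoS sF0; have sG1 := smooth_uptoS sG0.
case: sF0 => cF dF; case: sG0 => cG dG.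
split=> [z Oz|v]; first by apply: cvgM; [exact: cF|exact: cG].
have [dFv sF] := dF v; have [dGv sG] := dG v.
split=> [z Oz|]; first by apply: derivableM; [exact: dFv|exact: dGv].
apply: (@smooth_upto_ext k O (fun z => F z * 'D_v G z + G z * 'D_v F z)) => //.
  by move=> z Oz; rewrite deriveM //; [exact: dFv|exact: dGv].
by apply: smooth_uptoD => //; apply: IH.
Qed.

Lemma smooth_upto_cst k O (a : R) : smooth_upto k O (fun=> a).
Proof.
elim: k a => [|k IH] a /=; (split => [z _|]; first exact: cvg_cst) => // v.
split=> [z _|]; first exact: derivable_cst.
by rewrite (_ : 'D_v (fun=> a) = fun=> 0); [exact: IH|apply/funext => z; exact: derive_cst].
Qed.

End RealCalculus.


(* C^n is handled through its underlying real space, z = x + i y <-> (x, y). *)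
Definition cspace (R : realType) (n : nat) := ('rV[R]_n * 'rV[R]_n)%type.

Section ComplexCoordinates.
Variables (R : realType) (n : nat).
HB.instance Definition _ := NormedModule.on (cspace R n).
Implicit Types (v z : cspace R n).

Definition ccoord v (k : 'I_n) : R[i] := (v.1 0 k +i* v.2 0 k)%C.
Definition mulI v : cspace R n := (- v.2, v.1).
Definition evx (k : 'I_n) : cspace R n := (delta_mx 0 k, 0).
Definition evy (k : 'I_n) : cspace R n := (0, delta_mx 0 k).
End ComplexCoordinates.

Record complex_manifold (R : realType) (n : nat) (M : topologicalType) :=
  ComplexManifold {
  chart_idx : Type;
  dom : chart_idx -> set M;
  coo : chart_idx -> M -> cspace R n;
  uncoo : chart_idx -> cspace R n -> M;
  chart_at : M -> chart_idx;
  dom_open : forall i, open (dom i);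
  dom_at : forall x, dom (chart_at x) x;
  coo_continuous : forall i x, dom i x -> {for x, continuous (coo i)};
  img_open : forall i, open (coo i @` dom i);
  cooK : forall i x, dom i x -> uncoo i (coo i x) = x;
  uncoo_continuous : forall i z, (coo i @` dom i) z ->
    {for z, continuous (uncoo i)};
  transition_smooth : forall i j (k : 'I_n),
    smooth (coo i @` (dom i `&` dom j))
      (fun z => complex.Re (ccoord (coo j (uncoo i z)) k)) /\
    smooth (coo i @` (dom i `&` dom j))
      (fun z => complex.Im (ccoord (coo j (uncoo i z)) k));
  (* the differential of a coordinate change is complex linear *)
  transition_holomorphic : forall i j x v, dom i x -> dom j x ->
    'D_(mulI v) (coo j \o uncoo i) (coo i x) =
    mulI ('D_v (coo j \o uncoo i) (coo i x)) }.

Section Functions.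
Variables (R : realType) (n : nat) (M : topologicalType).
Variable (X : complex_manifold R n M).
Local Notation I := (chart_idx X).
Implicit Types (f g : M -> R[i]) (O : set M) (i j : I).

Definition cont_at f x :=
  {for x, continuous (fun y => complex.Re (f y))} /\
  {for x, continuous (fun y => complex.Im (f y))}.

Definition smooth_on O f := forall i,
  smooth (coo i @` (O `&` dom i)) (fun z => complex.Re (f (uncoo i z))) /\
  smooth (coo i @` (O `&` dom i)) (fun z => complex.Im (f (uncoo i z))).

(* The derivative along the constant vector field [v] of the chart [i], and its
   Wirtinger combinations d/dz^k and d/d\bar z^k. *)
Definition pd i (v : cspace R n) f (x : M) : R[i] :=
  ('D_v (fun z => complex.Re (f (uncoo i z)) : R) (coo i x) +i*
   'D_v (fun z => complex.Im (f (uncoo i z)) : R) (coo i x))%C.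

Definition pd10 i k f x : R[i] := 2^-1 * (pd i (evx R k) f x - 'i * pd i (evy R k) f x).
Definition pd01 i k f x : R[i] := 2^-1 * (pd i (evx R k) f x + 'i * pd i (evy R k) f x).

(* Change of coordinates of real tangent vectors from the chart [i] to the
   chart [j], and the complex Jacobian matrix d z_j^l / d z_i^k. *)
Definition tchange i j (x : M) (u : cspace R n) : cspace R n :=
  'D_u (coo j \o uncoo i) (coo i x).

Definition jac i j (x : M) : 'M[R[i]]_n :=
  \matrix_(k, l) ccoord (tchange i j x (evx R k)) l.

Lemma img_openI i O : open O -> open (coo i @` (O `&` dom i)).
Proof.
move=> oO.
have -> : coo i @` (O `&` dom i) = coo i @` dom i `&` uncoo i @^-1` O.
  apply/seteqP; split=> [_ [x [Ox dx] <-]|_ [[x dx <-]]] /=.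
    by split; [exists x|rewrite /= cooK].
  by rewrite cooK // => Ox; exists x.
rewrite openE => z [dz Oz]; apply: filterI.
  by apply: open_nbhs_nbhs; split=> //; exact: img_open.
by apply: (uncoo_continuous dz); exact: open_nbhs_nbhs.
Qed.

Lemma smooth_on_ext O f g : open O -> (forall x, O x -> f x = g x) ->
  smooth_on O f -> smooth_on O g.
Proof.
move=> oO fg sf i; have [sR sI] := sf i; split=> k.
  apply: smooth_upto_ext (sR k); first exact: img_openI.
  by move=> _ [x [Ox dx] <-]; rewrite cooK // fg.
apply: smooth_upto_ext (sI k); first exact: img_openI.
by move=> _ [x [Ox dx] <-]; rewrite cooK // fg.
Qed.

Lemma smooth_upto_sub k (E : normedModType R) (A B : set E) F :
  A `<=` B -> smooth_upto k B F -> smooth_upto k A F.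
Proof.
move=> AB; elim: k F => [|k IH] F [cF dF]; (split; first by move=> z /AB/cF) => //.
by move=> v; have [dFv sF] := dF v; split; [move=> z /AB/dFv|exact: IH].
Qed.

Lemma smooth_onS O O' f : O `<=` O' -> smooth_on O' f -> smooth_on O f.
Proof.
move=> OO sf i; have [sR sI] := sf i.
have h : coo i @` (O `&` dom i) `<=` coo i @` (O' `&` dom i).
  by move=> _ [x [Ox dx] <-]; exists x => //; split => //; exact: OO.
by split=> k; [exact: smooth_upto_sub h (sR k)|exact: smooth_upto_sub h (sI k)].
Qed.

Lemma smooth_on_cst O (a : R[i]) : smooth_on O (fun=> a).
Proof. by move=> i; split=> k; exact: smooth_upto_cst. Qed.

Lemma smooth_onD O f g : open O -> smooth_on O f -> smooth_on O g ->
  smooth_on O (fun x => f x + g x).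
Proof.
move=> oO sf sg i; have [fR fI] := sf i; have [gR gI] := sg i.
have o := img_openI (i := i) oO; split=> k.
  rewrite (_ : (fun z => _) = fun z => complex.Re (f (uncoo i z)) +
    complex.Re (g (uncoo i z))) ?raddfD //; first exact: smooth_uptoD.
  by apply/funext => z; rewrite raddfD.
rewrite (_ : (fun z => _) = fun z => complex.Im (f (uncoo i z)) +
    complex.Im (g (uncoo i z))) ?raddfD //; first exact: smooth_uptoD.
by apply/funext => z; rewrite raddfD.
Qed.

Lemma Re_mul (a b : R[i]) : complex.Re (a * b) =
  complex.Re a * complex.Re b + (-1) * (complex.Im a * complex.Im b).
Proof. by case: a b => [a b] [c d] /=; rewrite mulN1r. Qed.

Lemma Im_mul (a b : R[i]) : complex.Im (a * b) =
  complex.Re a * complex.Im b + complex.Im a * complex.Re b.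
Proof. by case: a b => [a b] [c d]. Qed.

Lemma smooth_onM O f g : open O -> smooth_on O f -> smooth_on O g ->
  smooth_on O (fun x => f x * g x).
Proof.
move=> oO sf sg i; have [fR fI] := sf i; have [gR gI] := sg i.
have o := img_openI (i := i) oO; split=> k.
  under eq_fun do rewrite Re_mul.
  apply: smooth_uptoD => //; first exact: smooth_uptoM.
  by apply: smooth_uptoM => //; [exact: smooth_upto_cst|exact: smooth_uptoM].
under eq_fun do rewrite Im_mul.
by apply: smooth_uptoD => //; exact: smooth_uptoM.
Qed.

Lemma cont_at_cst x (a : R[i]) : cont_at (fun=> a) x.
Proof. by split; exact: cvg_cst. Qed.

Lemma cont_atD f g x : cont_at f x -> cont_at g x ->
  cont_at (fun x => f x + g x) x.
Proof.
move=> [fR fI] [gR gI]; split.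
  rewrite (_ : (fun y => _) = fun y => complex.Re (f y) + complex.Re (g y)).
    by apply: cvgD; [exact: fR|exact: gR].
  by apply/funext => z; rewrite raddfD.
rewrite (_ : (fun y => _) = fun y => complex.Im (f y) + complex.Im (g y)).
  by apply: cvgD; [exact: fI|exact: gI].
by apply/funext => z; rewrite raddfD.
Qed.

Lemma cont_atM f g x : cont_at f x -> cont_at g x ->
  cont_at (fun x => f x * g x) x.
Proof.
move=> [fR fI] [gR gI]; split.
  rewrite (_ : (fun y => _) = fun y => complex.Re (f y) * complex.Re (g y) +
    (-1) * (complex.Im (f y) * complex.Im (g y))); last first.
    by apply/funext => z; rewrite Re_mul.
  apply: cvgD; first by apply: cvgM; [exact: fR|exact: gR].
  by apply: cvgM; [exact: cvg_cst|apply: cvgM; [exact: fI|exact: gI]].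
rewrite (_ : (fun y => _) = fun y => complex.Re (f y) * complex.Im (g y) +
  complex.Im (f y) * complex.Re (g y)); last first.
  by apply/funext => z; rewrite Im_mul.
by apply: cvgD; apply: cvgM; [exact: fR|exact: gI|exact: fI|exact: gR].
Qed.

Lemma cont_at_ext O f g x : open O -> O x -> (forall y, O y -> f y = g y) ->
  cont_at f x -> cont_at g x.
Proof.
move=> oO Ox fg [fR fI].
have e : \near x, f x = g x.
  by near=> y; apply: fg; near: y; exact: open_nbhs_nbhs.
split.
  by apply: cont_ext fR; [rewrite fg|apply: filterS e => y ->].
by apply: cont_ext fI; [rewrite fg|apply: filterS e => y ->].
Unshelve. all: by end_near. Qed.

Lemma smooth_on_cont O f x : open O -> O x -> smooth_on O f -> cont_at f x.
Proof.
move=> oO Ox sf; have [sR sI] := sf (chart_at X x).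
set i := chart_at X x in sR sI; have dx : dom i x := dom_at X x.
have e : \near x, dom i x by apply: open_nbhs_nbhs; split=> //; exact: dom_open.
have cc := coo_continuous dx.
have h (g : M -> R) : {for coo i x, continuous (fun z => g (uncoo i z))} ->
    {for x, continuous g}.
  move=> cg; have : {for x, continuous (fun y => g (uncoo i (coo i y)))}.
    exact: (@continuous_comp _ _ _ (coo i) (fun z => g (uncoo i z))).
  apply: cont_ext; first by rewrite cooK.
  by near=> y; rewrite cooK //; near: y.
have Oi : (coo i @` (O `&` dom i)) (coo i x) by exists x.
by split; apply: h; [apply: (sR 0%N).1|apply: (sI 0%N).1].
Unshelve. all: by end_near. Qed.

Lemma smooth_upto_local k (E : normedModType R) (A : set E) F :
  (forall z, A z -> exists2 B, B z & smooth_upto k B F) -> smooth_upto k A F.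
Proof.
elim: k F => [|k IH] F h /=.
  by split=> // z /h[B Bz [cF _]]; exact: cF.
split=> [z /h[B Bz [cF _]]|v]; first exact: cF.
split=> [z /h[B Bz [_ /(_ v)[dF _]]]|]; first exact: dF.
by apply: IH => z /h[B Bz [_ /(_ v)[_ sF]]]; exists B.
Qed.

Lemma smooth_on_local O f :
  (forall x, O x -> exists2 O', O' x & smooth_on O' f) -> smooth_on O f.
Proof.
move=> h i; split=> k; apply: smooth_upto_local => _ [x [Ox dx] <-];
  case: (h x Ox) => O' O'x /(_ i)[sR sI]; exists (coo i @` (O' `&` dom i)) => //;
  by exists x.
Qed.

Lemma smooth_on_sum (J : Type) (r : seq J) O (f : J -> M -> R[i]) : open O ->
  (forall p, smooth_on O (f p)) -> smooth_on O (fun x => \sum_(p <- r) f p x).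
Proof.
move=> oO sf; elim: r => [|p r IH].
  rewrite (_ : (fun x => _) = fun=> 0); first exact: smooth_on_cst.
  by apply/funext => x; rewrite big_nil.
rewrite (_ : (fun x => _) = fun x => f p x + \sum_(p <- r) f p x).
  exact: smooth_onD.
by apply/funext => x; rewrite big_cons.
Qed.

Lemma cont_at_sum (J : Type) (r : seq J) x (f : J -> M -> R[i]) :
  (forall p, cont_at (f p) x) -> cont_at (fun x => \sum_(p <- r) f p x) x.
Proof.
move=> cf; elim: r => [|p r IH].
  rewrite (_ : (fun x => _) = fun=> 0); first exact: cont_at_cst.
  by apply/funext => y; rewrite big_nil.
rewrite (_ : (fun x => _) = fun x => f p x + \sum_(p <- r) f p x).
  exact: cont_atD.
by apply/funext => y; rewrite big_cons.
Qed.

End Functions.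


Section SectionSpace.
Variables (R : realType) (M : Type).
Definition sec (F : M -> lmodType R[i]) := forall x, F x.
Variable F : M -> lmodType R[i].
HB.instance Definition _ := gen_eqMixin (sec F).
HB.instance Definition _ := gen_choiceMixin (sec F).

Definition sec_add (s t : sec F) : sec F := fun x => s x + t x.
Definition sec_zero : sec F := fun=> 0.
Definition sec_opp (s : sec F) : sec F := fun x => - s x.
Definition sec_scale (a : R[i]) (s : sec F) : sec F := fun x => a *: s x.

Fact sec_addA : associative sec_add.
Proof. by move=> s t u; apply: functional_extensionality_dep => x; exact: addrA. Qed.
Fact sec_addC : commutative sec_add.
Proof. by move=> s t; apply: functional_extensionality_dep => x; exact: addrC. Qed.
Fact sec_add0 : left_id sec_zero sec_add.
Proof. by move=> s; apply: functional_extensionality_dep => x; exact: add0r. Qed.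
Fact sec_addN : left_inverse sec_zero sec_opp sec_add.
Proof. by move=> s; apply: functional_extensionality_dep => x; exact: addNr. Qed.
HB.instance Definition _ :=
  GRing.isZmodule.Build (sec F) sec_addA sec_addC sec_add0 sec_addN.
Fact sec_scaleA a b s : sec_scale a (sec_scale b s) = sec_scale (a * b) s.
Proof. by apply: functional_extensionality_dep => x; exact: scalerA. Qed.
Fact sec_scale1 : left_id 1 sec_scale.
Proof. by move=> s; apply: functional_extensionality_dep => x; exact: scale1r. Qed.
Fact sec_scaleDr : right_distributive sec_scale +%R.
Proof. by move=> a s t; apply: functional_extensionality_dep => x; exact: scalerDr. Qed.
Fact sec_scaleDl s : {morph sec_scale^~ s : a b / a + b}.
Proof. by move=> a b; apply: functional_extensionality_dep => x; exact: scalerDl. Qed.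
HB.instance Definition _ := GRing.Zmodule_isLmodule.Build R[i] (sec F)
  sec_scaleA sec_scale1 sec_scaleDr sec_scaleDl.
End SectionSpace.

Record linear_subspace (R : realType) (U : lmodType R[i]) := LinearSubspace {
  in_sub :> U -> Prop;
  in_sub0 : in_sub 0;
  in_sub_lin : forall a u v, in_sub u -> in_sub v -> in_sub (a *: u + v) }.

Section SubspaceElements.
Variables (R : realType) (U : lmodType R[i]) (S : linear_subspace U).
Definition elt_pred : {pred U} := [pred u | `[< S u >]].
Fact elt_pred_closed : submod_closed elt_pred.
Proof.
split=> [|a u v].
  by apply/asboolP; exact: (in_sub0 S).
by move=> /asboolP Su /asboolP Sv; apply/asboolP; exact: (in_sub_lin a Su Sv).
Qed.
HB.instance Definition _ := GRing.isSubmodClosed.Build R[i] U elt_pred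
  elt_pred_closed.
Record elt := Elt_ { elt_val :> U; _ : elt_val \in elt_pred }.
HB.instance Definition _ := [isSub for elt_val].
HB.instance Definition _ := [Choice of elt by <:].
HB.instance Definition _ := [SubChoice_isSubLmodule of elt by <:].
Definition Elt u (Su : S u) : elt := Elt_ (asboolT Su : u \in elt_pred).
Lemma eltP (u : elt) : S (elt_val u).
Proof. by case: u => u /= /asboolP. Qed.
End SubspaceElements.

(* The frames [fr] play the role of local trivializations. *)
Record vector_bundle (R : realType) (n : nat) (M : topologicalType)
    (X : complex_manifold R n M) := VectorBundle {
  fib : M -> vectType R[i];
  rank : nat;
  fr_idx : Type;
  fr_dom : fr_idx -> set M;
  fr : fr_idx -> forall x, rank.-tuple (fib x);
  fr_at : M -> fr_idx;
  fr_open : forall j, open (fr_dom j);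
  fr_dom_at : forall x, fr_dom (fr_at x) x;
  fr_basis : forall j x, fr_dom j x -> basis_of fullv (fr j x);
  fr_smooth : forall j k a b, smooth_on X (fr_dom j `&` fr_dom k)
    (fun x => coord (fr k x) b (tnth (fr j x) a)) }.

Notation section E := (sec (fun x => fib E x)).

Section BundleSections.
Variables (R : realType) (n : nat) (M : topologicalType).
Variable (X : complex_manifold R n M).
Implicit Types (E V W : vector_bundle X) (O : set M).

Definition smooth_sec E O (s : section E) := forall j a,
  smooth_on X (O `&` fr_dom j) (fun x => coord (fr j x) a (s x)).

Definition cont_sec_at E (s : section E) x := forall j a, fr_dom j x ->
  cont_at (fun y => coord (fr (v := E) j y) a (s y)) x.

(* Smoothness of a section of Hom(V, E), through its local matrices. *)
Definition smooth_hom V E O (A : sec (fun x => 'Hom(fib V x, fib E x))) :=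
  forall j l a b, smooth_on X (O `&` (fr_dom j `&` fr_dom l))
    (fun x => coord (fr l x) b (A x (tnth (fr j x) a))).

Lemma smooth_sec_lin E O c (s t : section E) : open O ->
  smooth_sec O s -> smooth_sec O t -> smooth_sec O (c *: s + t).
Proof.
move=> oO ss st j a; have o : open (O `&` fr_dom j) by apply: openI => //; exact: fr_open.
rewrite (_ : (fun x => _) = fun x => c * coord (fr (v := E) j x) a (s x) +
  coord (fr j x) a (t x)); last by apply/funext => x; rewrite linearP.
by apply: smooth_onD => //; apply: smooth_onM => //; exact: smooth_on_cst.
Qed.

Lemma smooth_sec0 E O : smooth_sec O (0 : section E).
Proof.
move=> j a; rewrite (_ : (fun x => _) = fun=> 0); first exact: smooth_on_cst.
by apply/funext => x; exact: linear0.
Qed.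

Lemma cont_sec_lin E c (s t : section E) x :
  cont_sec_at s x -> cont_sec_at t x -> cont_sec_at (c *: s + t) x.
Proof.
move=> cs ct j a dj; rewrite (_ : (fun x => _) = fun x =>
  c * coord (fr (v := E) j x) a (s x) + coord (fr j x) a (t x)).
  by apply: cont_atD; [apply: cont_atM; [exact: cont_at_cst|exact: cs]|exact: ct].
by apply/funext => y; rewrite linearP.
Qed.

Lemma cont_sec0 E x : cont_sec_at (0 : section E) x.
Proof.
move=> j a _; rewrite (_ : (fun x => _) = fun=> 0); first exact: cont_at_cst.
by apply/funext => y; exact: linear0.
Qed.

Lemma coord_hom V E (A : sec (fun x => 'Hom(fib V x, fib E x))) (s : section V)
    j l b x : fr_dom j x ->
  coord (fr (v := E) l x) b (A x (s x)) =
  \sum_a coord (fr j x) a (s x) * coord (fr l x) b (A x (tnth (fr j x) a)).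
Proof.
move=> dj; rewrite {1}(coord_basis (fr_basis dj) (memvf (s x))) !linear_sum /=.
by apply: eq_bigr => a _; rewrite !linearZ /= (tnth_nth 0).
Qed.

Lemma smooth_sec_hom V E O (A : sec (fun x => 'Hom(fib V x, fib E x)))
    (s : section V) : open O ->
  smooth_hom O A -> smooth_sec O s -> smooth_sec O ((fun x => A x (s x)) : section E).
Proof.
move=> oO sA ss l b; apply: smooth_on_local => x [Ox dl]; set j := fr_at V x.
have dj : fr_dom j x by exact: fr_dom_at.
have oD : open (O `&` (fr_dom j `&` fr_dom l)).
  by apply: openI => //; apply: openI; exact: fr_open.
exists (O `&` (fr_dom j `&` fr_dom l)) => //.
apply: (@smooth_on_ext _ _ _ X (O `&` (fr_dom j `&` fr_dom l)) (fun x =>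
  \sum_a coord (fr j x) a (s x) * coord (fr l x) b (A x (tnth (fr j x) a)))) => //.
  by move=> y [_ [djy _]]; rewrite -coord_hom.
apply: smooth_on_sum => // a; apply: smooth_onM => //.
by apply: smooth_onS (ss j a) => y [Oy [djy _]].
Qed.

Lemma smooth_sec_cont E O (s : section E) x : open O -> O x ->
  smooth_sec O s -> cont_sec_at s x.
Proof.
move=> oO Ox ss j a dj; apply: (@smooth_on_cont _ _ _ X (O `&` fr_dom j)) => //.
by apply: openI => //; exact: fr_open.
Qed.

Lemma cont_sec_hom V E O (A : sec (fun x => 'Hom(fib V x, fib E x)))
    (s : section V) x : open O -> O x ->
  smooth_hom O A -> cont_sec_at s x -> cont_sec_at ((fun x => A x (s x)) : section E) x.
Proof.
move=> oO Ox sA cs l b dl; set j := fr_at V x.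
have dj : fr_dom j x by exact: fr_dom_at.
have oD : open (O `&` (fr_dom j `&` fr_dom l)).
  by apply: openI => //; apply: openI; exact: fr_open.
apply: (cont_at_ext oD _ _ (f := fun x =>
  \sum_a coord (fr j x) a (s x) * coord (fr l x) b (A x (tnth (fr j x) a)))) => //.
  by move=> y [_ [djy _]]; rewrite -coord_hom.
apply: cont_at_sum => a; apply: cont_atM; first exact: cs.
exact: (smooth_on_cont oD).
Qed.
End BundleSections.


Fact scale_swap (K : comNzRingType) (V : lmodType K) (a b : K) (v : V) :
  a *: (b *: v) = b *: (a *: v).
Proof. by rewrite !scalerA mulrC. Qed.

(* [nabla i v s] is the derivative of [s] along the constant real vector field
   [v] of the chart [i], meaningful on [dom i]; [nabla] acts on local sections,
   a local section on [O] being the germ along [O] of a total one. *)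
Record connection (R : realType) (n : nat) (M : topologicalType)
    (X : complex_manifold R n M) (E : vector_bundle X) := Connection {
  nabla : chart_idx X -> cspace R n -> section E -> section E;
  nabla_local : forall (O : set M) i v (s t : section E) x, open O -> O x ->
    dom i x -> smooth_sec O s -> smooth_sec O t ->
    (forall y, O y -> s y = t y) -> nabla i v s x = nabla i v t x;
  nabla_lin : forall (O : set M) i v a (s t : section E) x, open O -> O x ->
    dom i x -> smooth_sec O s -> smooth_sec O t ->
    nabla i v (a *: s + t) x = a *: nabla i v s x + nabla i v t x;
  nabla_leibniz : forall (O : set M) i v f (s : section E) x, open O -> O x ->
    dom i x -> smooth_on X O f -> smooth_sec O s ->
    nabla i v (fun y => f y *: s y) x = pd i v f x *: s x + f x *: nabla i v s x;
  nabla_dir : forall (O : set M) i (r : R) u v (s : section E) x, open O ->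
    O x -> dom i x -> smooth_sec O s ->
    nabla i (r *: u + v) s x = (r%:C)%C *: nabla i u s x + nabla i v s x;
  nabla_smooth : forall (O : set M) i v (s : section E), open O ->
    smooth_sec O s -> smooth_sec (O `&` dom i) (nabla i v s);
  nabla_chart : forall (O : set M) i j v (s : section E) x, open O -> O x ->
    dom i x -> dom j x -> smooth_sec O s ->
    nabla i v s x = nabla j (tchange i j x v) s x }.

Section Connections.
Variables (R : realType) (n : nat) (M : topologicalType).
Variables (X : complex_manifold R n M) (E : vector_bundle X).
Implicit Types (D : connection E).

Definition nabla10 D i k (s : section E) : section E := fun x =>
  2^-1 *: (nabla D i (evx R k) s x - 'i *: nabla D i (evy R k) s x).
Definition nabla01 D i k (s : section E) : section E := fun x =>
  2^-1 *: (nabla D i (evx R k) s x + 'i *: nabla D i (evy R k) s x).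

Lemma nabla10_lin D (O : set M) i k a (s t : section E) x : open O -> O x ->
  dom i x -> smooth_sec O s -> smooth_sec O t ->
  nabla10 D i k (a *: s + t) x = a *: nabla10 D i k s x + nabla10 D i k t x.
Proof.
move=> oO Ox dx ss st; rewrite /nabla10.
rewrite !(nabla_lin _ _ _ oO Ox dx ss st) scale_swap -scalerDr; congr (_ *: _).
by rewrite scalerDr [_ *: (a *: _)]scale_swap scalerBr opprD addrACA.
Qed.

Lemma nabla01_lin D (O : set M) i k a (s t : section E) x : open O -> O x ->
  dom i x -> smooth_sec O s -> smooth_sec O t ->
  nabla01 D i k (a *: s + t) x = a *: nabla01 D i k s x + nabla01 D i k t x.
Proof.
move=> oO Ox dx ss st; rewrite /nabla01.
rewrite !(nabla_lin _ _ _ oO Ox dx ss st) scale_swap -scalerDr; congr (_ *: _).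
by rewrite scalerDr [_ *: (a *: _)]scale_swap scalerDr addrACA.
Qed.

(* [D] has curvature -i theta. *)
Definition has_curvature D (theta : chart_idx X -> M -> cspace R n ->
    cspace R n -> R[i]) :=
  forall (O : set M) i u v (s : section E) x, open O -> O x -> dom i x ->
    smooth_sec O s ->
    nabla D i u (nabla D i v s) x - nabla D i v (nabla D i u s) x =
    (- 'i * theta i x u v) *: s x.
End Connections.

Record hermitian_metric (R : realType) (n : nat) (M : topologicalType)
    (X : complex_manifold R n M) (E : vector_bundle X) := HermitianMetric {
  hm :> forall x, fib E x -> fib E x -> R[i];
  hm_lin : forall x a u v w, hm (x := x) (a *: u + v) w = a * hm u w + hm v w;
  hm_conj : forall x u v, hm (x := x) v u = conjc (hm u v);
  hm_pos : forall x u, u != 0 -> 0 < hm (x := x) u u;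
  hm_smooth : forall j a b, smooth_on X (fr_dom j)
    (fun x => hm (tnth (fr j x) a) (tnth (fr j x) b)) }.

Section LineBundles.
Variables (R : realType) (n : nat) (M : topologicalType).
Variables (X : complex_manifold R n M).
Implicit Types (E F G : vector_bundle X).

Definition compatible E (h : hermitian_metric E) (D : connection E) :=
  forall (O : set M) i u (s t : section E) x, open O -> O x -> dom i x ->
    smooth_sec O s -> smooth_sec O t ->
    pd i u (fun y => h y (s y) (t y)) x =
    h x (nabla D i u s x) (t x) + h x (s x) (nabla D i u t x).

(* The holomorphic structure of a line bundle with connection [D] is the one
   with Dolbeault operator D^{0,1}; positivity of the line bundle refers to the
   Chern connection of some Hermitian metric. *)
Definition positive_line_bundle E (D : connection E) :=
  exists (h : hermitian_metric E) (D' : connection E) theta,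
    [/\ compatible h D',
        forall (O : set M) i k (s : section E) x, open O -> O x -> dom i x ->
          smooth_sec O s -> nabla01 D' i k s x = nabla01 D i k s x,
        has_curvature D' theta &
        forall i x u, dom i x -> u != 0 -> 0 < theta i x u (mulI u)].

(* The defining frames of [E] are holomorphic for [D]: [E] is a holomorphic
   bundle and the (0,1)-part of [D] is its Dolbeault operator. *)
Definition holomorphic_bundle E (D : connection E) :=
  (forall j k a b (i : chart_idx X) l x, fr_dom j x -> fr_dom k x -> dom i x ->
     pd01 i l (fun y => coord (fr (v := E) k y) b (tnth (fr j y) a)) x = 0) /\
  (forall j a (i : chart_idx X) l x, fr_dom j x -> dom i x ->
     nabla01 D i l (fun y => tnth (fr (v := E) j y) a) x = 0).

(* [G], with [DG], is the tensor product of the line bundles [E] and [F]: in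
   rank one, a fibrewise bilinear map without zero divisors is universal. *)
Record is_tensor E (DE : connection E) F (DF : connection F)
    G (DG : connection G)
    (tens : forall x, fib E x -> fib F x -> fib G x) : Prop := IsTensor {
  tens_linl : forall x a u v w, tens x (a *: u + v) w = a *: tens x u w + tens x v w;
  tens_linr : forall x a u v w, tens x w (a *: u + v) = a *: tens x w u + tens x w v;
  tens_neq0 : forall x u v, u != 0 -> v != 0 -> tens x u v != 0;
  tens_smooth : forall (O : set M) (s : section E) (t : section F), open O ->
    smooth_sec O s -> smooth_sec O t ->
    smooth_sec O ((fun x => tens x (s x) (t x)) : section G);
  tens_nabla : forall (O : set M) i v (s : section E) (t : section F) x,
    open O -> O x -> dom i x -> smooth_sec O s -> smooth_sec O t ->
    nabla DG i v (fun y => tens y (s y) (t y)) x =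
    tens x (nabla DE i v s x) (t x) + tens x (s x) (nabla DF i v t x) }.
End LineBundles.

Definition gpair (R : realType) n (G : 'M[R[i]]_n) (u v : cspace R n) : R[i] :=
  \sum_k \sum_l G k l * ccoord u k * conjc (ccoord v l).

(* [gm i x k l] is the component g_{k \bar l} of g in the chart [i]. *)
Record kahler_metric (R : realType) (n : nat) (M : topologicalType)
    (X : complex_manifold R n M) := KahlerMetric {
  gm : chart_idx X -> M -> 'M[R[i]]_n;
  gm_smooth : forall i k l, smooth_on X (dom i) (fun x => gm i x k l);
  gm_herm : forall i x k l, dom i x -> gm i x l k = conjc (gm i x k l);
  gm_pos : forall i x u, dom i x -> u != 0 -> 0 < gpair (gm i x) u u;
  gm_chart : forall i j x u v, dom i x -> dom j x -> gpair (gm i x) u v =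
    gpair (gm j x) (tchange i j x u) (tchange i j x v);
  (* the Kaehler form is closed *)
  gm_closed : forall i k l m x, dom i x ->
    pd10 i k (fun y => gm i y l m) x = pd10 i l (fun y => gm i y k m) x }.

Section Kahler.
Variables (R : realType) (n : nat) (M : topologicalType).
Variables (X : complex_manifold R n M) (g : kahler_metric X).
Local Notation I := (chart_idx X).

(* omega(u, v) = g(Ju, v) on real tangent vectors, i.e.
   omega = i g_{k \bar l} dz^k /\ d\bar z^l. *)
Definition kahler_form (i : I) x u v : R[i] :=
  'i * (gpair (gm g i x) u v - gpair (gm g i x) v u).

(* g^{k \bar m} and the only nonzero Christoffel symbols Gamma^l_{m k}, up to
   conjugation, of a Kaehler metric. *)
Definition ginv (i : I) x k m : R[i] := invmx (gm g i x) m k.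
Definition christoffel (i : I) x l m k : R[i] :=
  \sum_j ginv i x l j * pd10 i m (fun y => gm g i y k j) x.

Definition vector_field (Y : I -> M -> cspace R n) :=
  (forall i k, smooth_on X (dom i) (fun x => ccoord (Y i x) k)) /\
  (forall i j x, dom i x -> dom j x -> Y j x = tchange i j x (Y i x)).

Definition divergence (Y : I -> M -> cspace R n) x : R[i] :=
  let i := chart_at X x in let G y := \det (gm g i y) in
  \sum_k (G x)^-1 * (pd10 i k (fun y => G y * ccoord (Y i y) k) x +
                     pd01 i k (fun y => G y * conjc (ccoord (Y i y) k)) x).

Definition nabla_along (E : vector_bundle X) (D : connection E)
    (Y : I -> M -> cspace R n) (s : section E) : section E :=
  fun x => nabla D (chart_at X x) (Y (chart_at X x) x) s x.

End Kahler.

(* The (0,q)-forms with values in [F], all q together, by their components in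
   all the charts: eta i [:: k_1; ...; k_q] is the coefficient with indices
   \bar k_1 ... \bar k_q of the degree q part of eta in the chart [i]; it is
   set to 0 outside the domain of the chart. *)
Section Forms.
Variables (R : realType) (n : nat) (M : topologicalType).
Variables (X : complex_manifold R n M).
Local Notation I := (chart_idx X).

Definition aform (F : M -> lmodType R[i]) := I -> seq 'I_n -> sec F.
HB.instance Definition _ F := GRing.Lmodule.on (aform F).

Record is_form F (eta : aform F) : Prop := IsForm {
  form_out : forall i K x, ~ dom i x -> eta i K x = 0;
  form_alt : forall i K K' k l x,
    eta i (K ++ [:: k, l & K']) x = - eta i (K ++ [:: l, k & K']) x;
  form_chart : forall i j x q (K : q.-tuple 'I_n), dom i x -> dom j x ->
    eta i K x = \sum_(L : q.-tuple 'I_n)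
      (\prod_(p < q) conjc (jac i j x (tnth K p) (tnth L p))) *: eta j L x }.

Lemma is_form0 F : is_form (0 : aform F).
Proof.
split=> [//|i K K' k l x|i j x q K _ _]; first exact/esym/oppr0.
by rewrite big1 // => L _; exact: scaler0.
Qed.

Lemma is_form_lin F a (eta theta : aform F) :
  is_form eta -> is_form theta -> is_form (a *: eta + theta).
Proof.
move=> [e1 a1 c1] [e2 a2 c2]; split=> [i K x dx|i K K' k l x|i j x q K dx dx2].
- by rewrite -[LHS]/(a *: eta i K x + theta i K x) e1 // e2 // scaler0 addr0.
- rewrite -[LHS]/(a *: eta i _ x + theta i _ x) a1 a2 scalerN -opprD.
  by [].
- rewrite -[LHS]/(a *: eta i K x + theta i K x) (c1 _ j) // (c2 _ j) //.
  rewrite scaler_sumr -big_split /=; apply: eq_bigr => L _.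
  by rewrite scale_swap -scalerDr.
Qed.

Definition cont_form (E : vector_bundle X) (eta : aform (fun x => fib E x)) :=
  forall i K x, dom i x -> cont_sec_at (eta i K) x.

Program Definition cforms (E : vector_bundle X) :=
  @LinearSubspace R (aform (fun x => fib E x))
    (fun eta => is_form eta /\ cont_form eta) _ _.
Next Obligation. by move=> E; split=> [|i K x _]; [exact: is_form0|exact: cont_sec0]. Qed.
Next Obligation.
move=> E a eta theta [f1 c1] [f2 c2]; split; first exact: is_form_lin.
by move=> i K x dx; apply: cont_sec_lin; [exact: c1|exact: c2].
Qed.

Program Definition csections (E : vector_bundle X) :=
  @LinearSubspace R (section E) (fun s => forall x, cont_sec_at s x) _ _.
Next Obligation. by move=> E x; exact: cont_sec0. Qed.
Next Obligation. by move=> E a s t cs ct x; exact: cont_sec_lin. Qed.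

Definition scalar_form (alpha : aform (fun=> (R[i]^o : lmodType R[i]))) :=
  is_form alpha /\ forall i K x, dom i x -> cont_at (alpha i K) x.

(* The pointwise inner product of antiholomorphic forms induced by g, for which
   <d\bar z^m, d\bar z^k> = g^{k \bar m}. *)
Definition fpair (g : kahler_metric X)
    (alpha beta : aform (fun=> (R[i]^o : lmodType R[i]))) x : R[i] :=
  let i := chart_at X x in
  \sum_(q < n.+1) (q`!%:R)^-1 *
    \sum_(K : q.-tuple 'I_n) \sum_(L : q.-tuple 'I_n)
      (\prod_(p < q) ginv g i x (tnth L p) (tnth K p)) *
      alpha i K x * conjc (beta i L x).

Definition function_form (E : vector_bundle X) (s : section E) :
    aform (fun x => fib E x) :=
  fun i K x => if (K == [::]) && `[< dom i x >] then s x else 0.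
End Forms.


Section Dolbeault.
Variables (R : realType) (n : nat) (M : topologicalType).
Variables (X : complex_manifold R n M) (g : kahler_metric X).
Local Notation I := (chart_idx X).

(* The Dirac matrices in the coordinate basis (dz^k, d\bar z^m), acting on
   component arrays: i gamma^{\bar m} is exterior multiplication by d\bar z^m
   and i gamma^k is minus the contraction g^{k \bar m} iota_{\bar m}. *)
Definition gamma10 F (i : I) k (beta : seq 'I_n -> sec F) : seq 'I_n -> sec F :=
  fun K x => 'i *: \sum_m ginv g i x k m *: beta (m :: K) x.
Definition gamma01 F m (beta : seq 'I_n -> sec (M := M) (R := R) F) :
    seq 'I_n -> sec F :=
  fun K x => - 'i *: \sum_(p < size K | nth m K p == m)
    (-1) ^+ p *: beta (take p K ++ drop p.+1 K) x.

Lemma gamma01_cons F m (beta : seq 'I_n -> sec F) k K x :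
  gamma01 m beta (k :: K) x = (k == m)%:R *: (- 'i *: beta K x)
    - gamma01 m (fun K => beta (k :: K)) K x.
Proof.
rewrite /gamma01 big_mkcond big_ord_recl scalerDr /= drop0 expr0 scale1r.
congr (_ + _); first by case: eqP; rewrite ?scale1r ?scale0r ?scaler0.
rewrite -[RHS]scalerN -sumrN big_mkcond [in RHS]big_mkcond; congr (_ *: _).
by apply: eq_bigr => p _; rewrite /= exprS mulN1r scaleNr; case: ifP; rewrite ?oppr0.
Qed.

Lemma gamma01_lin F m a (beta beta' : seq 'I_n -> sec F) K x :
  gamma01 m (fun K x => a *: beta K x - beta' K x) K x =
  a *: gamma01 m beta K x - gamma01 m beta' K x.
Proof.
rewrite /gamma01 scale_swap -scalerBr; congr (_ *: _).
rewrite scaler_sumr -sumrB; apply: eq_bigr => p _.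
by rewrite scale_swap -scalerBr.
Qed.

(* gamma^mu gamma^nu + gamma^nu gamma^mu = g^{mu nu}, in the three next lemmas. *)
Lemma gamma_clifford11 F (i : I) k m (beta : seq 'I_n -> sec F) K x :
  gamma10 i k (gamma01 m beta) K x + gamma01 m (gamma10 i k beta) K x =
  ginv g i x k m *: beta K x.
Proof.
have ii : 'i * - 'i = 1 :> R[i] by rewrite mulrN -expr2 sqrCi opprK.
have -> : gamma01 m (gamma10 i k beta) K x =
    'i *: \sum_j ginv g i x k j *: gamma01 m (fun K => beta (j :: K)) K x.
  rewrite /gamma01 /gamma10.
  under eq_bigr do rewrite scale_swap.
  rewrite -scaler_sumr scale_swap; congr (_ *: _).
  under eq_bigr do rewrite scaler_sumr.
  rewrite exchange_big scaler_sumr /=; apply: eq_bigr => j _.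
  rewrite [RHS]scale_swap; congr (_ *: _); rewrite scaler_sumr.
  by apply: eq_bigr => p _; rewrite scale_swap.
rewrite /gamma10 -scalerDr -big_split /= (bigD1 m) //= big1 => [|j /negPf jm].
  by rewrite addr0 -scalerDr gamma01_cons eqxx subrK scale1r scale_swap [X in _ *: X]scalerA ii scale1r.
by rewrite -scalerDr gamma01_cons jm subrK scale0r scaler0.
Qed.

Lemma gamma_clifford20 F (i : I) k l (beta : seq 'I_n -> sec F) K x :
  (forall p q, beta [:: p, q & K] x = - beta [:: q, p & K] x) ->
  gamma10 i k (gamma10 i l beta) K x + gamma10 i l (gamma10 i k beta) K x = 0.
Proof.
move=> alt; rewrite /gamma10 -scalerDr.
under eq_bigr do rewrite scale_swap scaler_sumr.
under [X in _ + X]eq_bigr do rewrite scale_swap scaler_sumr.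
rewrite -!scaler_sumr -scalerDr exchange_big -big_split /=.
rewrite big1 ?scaler0 // => p _; rewrite -big_split big1 //= => q _.
by rewrite alt [X in _ + X]scale_swap !scalerN addNr.
Qed.

Lemma gamma_clifford02 F k m (beta : seq 'I_n -> sec F) K x :
  gamma01 k (gamma01 m beta) K x + gamma01 m (gamma01 k beta) K x = 0.
Proof.
elim: K beta => [|l K IH] beta.
  by rewrite /gamma01 /= !big_ord0 !scaler0 addr0.
have e p q : gamma01 p (gamma01 q beta) (l :: K) x =
    (l == p)%:R *: (- 'i *: gamma01 q beta K x)
    - (l == q)%:R *: (- 'i *: gamma01 p beta K x)
    + gamma01 p (gamma01 q (fun K => beta (l :: K))) K x.
  rewrite gamma01_cons -addrA; congr (_ + _).
  rewrite (_ : (fun K => gamma01 q beta (l :: K)) = fun K x =>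
    ((l == q)%:R * - 'i) *: beta K x - gamma01 q (fun K => beta (l :: K)) K x).
    by rewrite gamma01_lin opprB scalerA addrC.
  apply/funext => J; apply: functional_extensionality_dep => y.
  by rewrite gamma01_cons scalerA.
by rewrite !e addrACA IH addr0 addrA subrK subrr.
Qed.

Variables (V E : vector_bundle X) (DV : connection V) (DE : connection E).
Local Notation homform := (aform X (fun x => 'Hom(fib V x, fib E x))).
Implicit Types (psi : homform) (v : section V).

(* The pairing of an E (x) V^*-valued form with a section of V. *)
Definition pairing v psi : aform X (fun x => fib E x) :=
  fun i K x => psi i K x (v x).

(* (nabla_k psi)(v) and (nabla_{\bar m} psi)(v) for the connection on
   antiholomorphic forms with values in Hom(V, E) induced by the Levi-Civita
   connection, for which nabla_k d\bar z^l = 0, and by DV and DE: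
   (nabla psi)(v) = nabla (psi(v)) - psi(nabla v). *)
Definition hom_nabla10 i k psi v : seq 'I_n -> section E := fun K x =>
  nabla10 DE i k (pairing v psi i K) x - psi i K x (nabla10 DV i k v x).
Definition hom_nabla01 i m psi v : seq 'I_n -> section E := fun K x =>
  nabla01 DE i m (pairing v psi i K) x
  - \sum_(p < size K) \sum_l conjc (christoffel g i x l m (nth m K p)) *:
      pairing v psi i (set_nth m K p l) x
  - psi i K x (nabla01 DV i m v x).

(* (D psi)(v) with D = i gamma^mu nabla_mu; a Hom(V, E)-valued form is
   determined by its values on the smooth sections of V. *)
Definition dolbeault i psi v : seq 'I_n -> section E := fun K x =>
  'i *: (\sum_k gamma10 i k (hom_nabla10 i k psi v) K x +
         \sum_m gamma01 m (hom_nabla01 i m psi v) K x).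

Definition smooth_hom_form psi := forall i K, smooth_hom (dom i) (psi i K).

Lemma pairing_lin v a psi chi i K :
  pairing v (a *: psi + chi) i K = a *: pairing v psi i K + pairing v chi i K.
Proof.
apply: functional_extensionality_dep => x.
rewrite -[RHS]/(a *: psi i K x (v x) + chi i K x (v x)).
rewrite -[LHS]/((a *: psi i K x + chi i K x)%VF (v x)).
by rewrite add_lfunE scale_lfunE.
Qed.

Lemma hom_nabla10_lin i k a psi chi v K x : smooth_sec setT v -> dom i x ->
  smooth_hom_form psi -> smooth_hom_form chi ->
  hom_nabla10 i k (a *: psi + chi) v K x =
  a *: hom_nabla10 i k psi v K x + hom_nabla10 i k chi v K x.
Proof.
move=> sv dx sp sc; have oD := @dom_open _ _ _ X i.
have h (xi : homform) : smooth_hom_form xi -> smooth_sec (dom i) (pairing v xi i K).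
  move=> sx; apply: (smooth_sec_hom oD (sx i K)).
  by move=> j b; apply: smooth_onS (sv j b) => y [_ ?].
rewrite /hom_nabla10 pairing_lin (nabla10_lin _ _ _ oD dx dx (h _ sp) (h _ sc)).
rewrite -[(a *: psi + chi) i K x]/((a *: psi i K x + chi i K x)%VF).
by rewrite add_lfunE scale_lfunE scalerBr opprD addrACA.
Qed.

Lemma hom_nabla01_lin i m a psi chi v K x : smooth_sec setT v -> dom i x ->
  smooth_hom_form psi -> smooth_hom_form chi ->
  hom_nabla01 i m (a *: psi + chi) v K x =
  a *: hom_nabla01 i m psi v K x + hom_nabla01 i m chi v K x.
Proof.
move=> sv dx sp sc; have oD := @dom_open _ _ _ X i.
have h (xi : homform) : smooth_hom_form xi -> smooth_sec (dom i) (pairing v xi i K).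
  move=> sx; apply: (smooth_sec_hom oD (sx i K)).
  by move=> j b; apply: smooth_onS (sv j b) => y [_ ?].
rewrite /hom_nabla01 pairing_lin (nabla01_lin _ _ _ oD dx dx (h _ sp) (h _ sc)).
rewrite -[(a *: psi + chi) i K x]/((a *: psi i K x + chi i K x)%VF).
rewrite add_lfunE scale_lfunE 2!scalerBr [RHS]addrACA -opprD; congr (_ - _).
rewrite [RHS]addrACA -opprD; congr (_ - _).
rewrite scaler_sumr -big_split /=; apply: eq_bigr => p _.
rewrite scaler_sumr -big_split /=; apply: eq_bigr => l _.
by rewrite pairing_lin scale_swap -scalerDr.
Qed.

Lemma dolbeault_lin i a psi chi v K x : smooth_sec setT v -> dom i x ->
  smooth_hom_form psi -> smooth_hom_form chi ->
  dolbeault i (a *: psi + chi) v K x =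
  a *: dolbeault i psi v K x + dolbeault i chi v K x.
Proof.
move=> sv dx sp sc; rewrite /dolbeault scale_swap -scalerDr; congr (_ *: _).
rewrite scalerDr addrACA; congr (_ + _); rewrite scaler_sumr -big_split /=;
  apply: eq_bigr => k _.
  rewrite /gamma10 scale_swap -scalerDr; congr (_ *: _).
  rewrite scaler_sumr -big_split /=; apply: eq_bigr => m _.
  by rewrite hom_nabla10_lin // scale_swap -scalerDr.
rewrite /gamma01 scale_swap -scalerDr; congr (_ *: _).
rewrite scaler_sumr -big_split /=; apply: eq_bigr => p _.
by rewrite hom_nabla01_lin // scale_swap -scalerDr.
Qed.

Lemma smooth_hom_form_lin a psi chi : smooth_hom_form psi ->
  smooth_hom_form chi -> smooth_hom_form (a *: psi + chi).
Proof.
move=> sp sc i K j l b c; have := sp i K j l b c; have := sc i K j l b c.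
set O := dom i `&` _ => fc fp; have oO : open O.
  by apply: openI; [exact: dom_open|apply: openI; exact: fr_open].
apply: (smooth_on_ext oO (f := fun x =>
  a * coord (fr l x) c (psi i K x (tnth (fr j x) b)) +
  coord (fr l x) c (chi i K x (tnth (fr j x) b)))).
  move=> x _; rewrite -[(a *: psi + chi) i K x]/((a *: psi i K x + chi i K x)%VF).
  by rewrite add_lfunE scale_lfunE linearP.
by apply: smooth_onD => //; apply: smooth_onM => //; exact: smooth_on_cst.
Qed.

Lemma smooth_hom_form0 : smooth_hom_form (0 : homform).
Proof.
move=> i K j l b c; rewrite (_ : (fun x => _) = fun=> 0); first exact: smooth_on_cst.
by apply/funext => y; rewrite -[(0 : homform) i K y]/(0%VF) lfunE linear0.
Qed.

Lemma dolbeault0 i v K x : smooth_sec setT v -> dom i x ->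
  dolbeault i (0 : homform) v K x = 0.
Proof.
move=> sv dx; have s0 := smooth_hom_form0.
have := @dolbeault_lin i (-1) 0 0 v K x sv dx s0 s0.
by rewrite scaler0 addr0 scaleN1r addNr.
Qed.

End Dolbeault.


Section Spaces.
Variables (R : realType) (n : nat) (M : topologicalType).
Variables (X : complex_manifold R n M) (g : kahler_metric X).
Implicit Types (E V W : vector_bundle X).

Program Definition holomorphic_sections E (D : connection E) :=
  @LinearSubspace R (section E) (fun s => smooth_sec setT s /\
    forall i k x, dom i x -> nabla01 D i k s x = 0) _ _.
Next Obligation.
move=> E D; split=> [|i k x dx]; first exact: smooth_sec0.
have s0 := @smooth_sec0 _ _ _ _ E setT.
have := @nabla01_lin _ _ _ _ E D setT i k (-1) 0 0 x openT I dx s0 s0.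
by rewrite scaler0 addr0 scaleN1r addNr.
Qed.
Next Obligation.
move=> E D a s t [ss hs] [st ht]; split=> [|i k x dx].
  by apply: smooth_sec_lin => //; exact: openT.
by rewrite (nabla01_lin _ _ _ openT I dx ss st) hs // ht // scaler0 addr0.
Qed.

Program Definition dolbeault_kernel V (DV : connection V) E (DE : connection E) :=
  @LinearSubspace R (aform X (fun x => 'Hom(fib V x, fib E x)))
    (fun psi => [/\ is_form psi, smooth_hom_form psi &
       forall v i K x, smooth_sec setT v -> dom i x ->
         dolbeault g DV DE i psi v K x = 0]) _ _.
Next Obligation.
move=> V DV E DE; split=> [||v i K x sv dx]; first exact: is_form0.
  exact: smooth_hom_form0.
exact: dolbeault0.
Qed.
Next Obligation.
move=> V DV E DE a s t [fs ss hs] [ft st ht]; split=> [||v i K x sv dx].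
- exact: is_form_lin.
- exact: smooth_hom_form_lin.
- by rewrite dolbeault_lin // hs // ht // scaler0 addr0.
Qed.

Lemma function_form_cforms E (s : section E) :
  (forall x, cont_sec_at s x) -> cforms E (function_form s).
Proof.
move=> cs; split; first split.
- by move=> i K x dx; rewrite /function_form asboolF // andbF.
- move=> i K K' k l x; rewrite /function_form.
  by case: K => [|? ?] /=; rewrite oppr0.
- move=> i j x [|q] K di dj; rewrite /function_form.
    rewrite (big_pred1 (nil_tuple _)) => [|L]; last by rewrite [L]tuple0; exact/esym/eqP/val_inj.
    by rewrite big_ord0 scale1r tuple0 /= !asboolT.
  rewrite big1 => [|L _]; last by case/tupleP: L => l L; rewrite scaler0.
  by case/tupleP: K.
- move=> i [|k K] x dx j a dj; rewrite /function_form /=.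
    apply: (cont_at_ext (@dom_open _ _ _ X i) dx
      (f := fun y => coord (fr j y) a (s y))); last exact: cs.
    by move=> y dy; rewrite asboolT.
  rewrite (_ : (fun y => _) = fun=> 0); first exact: cont_at_cst.
  by apply/funext => y; exact: linear0.
Qed.

Lemma pairing_cforms V E (v : section V)
    (psi : aform X (fun x => 'Hom(fib V x, fib E x))) :
  (forall x, cont_sec_at v x) -> is_form psi -> smooth_hom_form psi ->
  cforms E (pairing v psi).
Proof.
move=> cv [po pa pc] sp; split; first split.
- by move=> i K x dx; rewrite /pairing po // lfunE.
- by move=> i K K' k l x; rewrite /pairing pa opp_lfunE.
- move=> i j x q K di dj; rewrite /pairing (pc _ _ _ _ _ di dj) sum_lfunE.
  by apply: eq_bigr => L _; rewrite scale_lfunE.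
- move=> i K x dx.
  exact: (cont_sec_hom (@dom_open _ _ _ X i) dx (sp i K)).
Qed.

Definition continuous_function := {f : M -> R[i] | forall x, cont_at f x}.

Lemma cont_sec_mul E (f : continuous_function) (s : section E) :
  (forall x, cont_sec_at s x) ->
  forall x, cont_sec_at ((fun y => sval f y *: s y) : section E) x.
Proof.
move=> cs x j a dj; rewrite (_ : (fun y => _) = fun y =>
  sval f y * coord (fr (v := E) j y) a (s y)).
  by apply: cont_atM; [exact: (svalP f)|exact: cs].
by apply/funext => y; rewrite linearZ.
Qed.

Section Multiplication.
Variables (E : vector_bundle X) (D : connection E).
Local Notation H := (elt (holomorphic_sections D)).

Lemma hol_cont (s : H) x : cont_sec_at (elt_val s) x.
Proof. by apply: (smooth_sec_cont openT) => //; exact: (eltP s).1. Qed.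

Definition hol_form (s : H) : elt (cforms E) :=
  Elt (function_form_cforms (hol_cont s)).

Definition mul_form (f : continuous_function) (s : H) : elt (cforms E) :=
  Elt (function_form_cforms (cont_sec_mul f (hol_cont s))).

Fact mul_form_linear f : linear (mul_form f).
Proof.
move=> a s t; apply/val_inj/funext => i; apply/funext => K.
apply: functional_extensionality_dep => x.
rewrite -[RHS]/(a *: elt_val (mul_form f s) i K x + elt_val (mul_form f t) i K x).
rewrite /= /function_form; case: ifP => _; last by rewrite scaler0 addr0.
by rewrite [a *: (_ *: _)]scale_swap -scalerDr.
Qed.
HB.instance Definition _ f := GRing.isLinear.Build R[i] H (elt (cforms E)) *:%R
  (mul_form f) (mul_form_linear f).

Variables (V : vector_bundle X) (DV : connection V).
Local Notation K := (elt (dolbeault_kernel DV D)).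

Fact pair_form_subproof (v : elt (csections V)) (psi : K) :
  cforms E (pairing (elt_val v) (elt_val psi)).
Proof.
by have [fp sp _] := eltP psi; apply: pairing_cforms => //; exact: (eltP v).
Qed.
Definition pair_form (v : elt (csections V)) (psi : K) : elt (cforms E) :=
  Elt (pair_form_subproof v psi).

Fact pair_form_linear v : linear (pair_form v).
Proof.
move=> a s t; apply/val_inj/funext => i; apply/funext => J.
have e : elt_val (a *: s + t) = a *: elt_val s + elt_val t by [].
by rewrite -[LHS]/(pairing (elt_val v) (elt_val (a *: s + t)) i J) e pairing_lin.
Qed.
HB.instance Definition _ v := GRing.isLinear.Build R[i] K (elt (cforms E)) *:%R
  (pair_form v) (pair_form_linear v).
End Multiplication.

Definition inner_product (U : lmodType R[i]) (P : U -> Prop) (b : U -> U -> R[i]) :=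
  [/\ forall a u v w, P u -> P v -> P w -> b (a *: u + v) w = a * b u w + b v w,
      forall u v, P u -> P v -> b v u = conjc (b u v) &
      forall u, P u -> u != 0 -> 0 < b u u].

End Spaces.


Record quantization_data (R : realType) (n : nat) (M : topologicalType)
    (X : complex_manifold R n M) (g : kahler_metric X) := QuantizationData {
  Lb : vector_bundle X;
  Lb_rank : rank Lb = 1%N;
  Lb_nabla : connection Lb;
  Lb_metric : hermitian_metric Lb;
  Lb_compatible : compatible Lb_metric Lb_nabla;
  Lb_curvature : has_curvature Lb_nabla (kahler_form g);
  LN : nat -> vector_bundle X;
  LN_rank : forall N, rank (LN N) = 1%N;
  LN_nabla : forall N, connection (LN N);
  LN_tens : forall N x, fib (LN N) x -> fib Lb x -> fib (LN N.+1) x;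
  LN_tensor : forall N,
    is_tensor (LN_nabla N) Lb_nabla (LN_nabla N.+1) (LN_tens (N := N));
  L0_holomorphic : holomorphic_bundle (LN_nabla 0);
  L1_positive : positive_line_bundle (LN_nabla 1);
  (* the pre-Hilbert structure on Gamma(M, L_0): it is C(M)-compatible, and
     compatible with the connection, i.e. the adjoint of nabla_Y is
     - nabla_Y - div Y for every real vector field Y *)
  ip0 : section (LN 0) -> section (LN 0) -> R[i];
  ip0_inner : inner_product (csections (LN 0)) ip0;
  ip0_local : forall (f : continuous_function R M) s t,
    csections (LN 0) s -> csections (LN 0) t ->
    ip0 (fun x => sval f x *: s x) t = ip0 s (fun x => conjc (sval f x) *: t x);
  ip0_compatible : forall Y s t, vector_field Y ->
    smooth_sec setT s -> smooth_sec setT t ->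
    ip0 (nabla_along (LN_nabla 0) Y s) t + ip0 s (nabla_along (LN_nabla 0) Y t)
      + ip0 (fun x => divergence g Y x *: s x) t = 0;
  (* the induced inner products on L_N-valued antiholomorphic forms, with
     <eta (x) l, theta (x) l'>_{N+1} = <(l, l') eta, theta>_N *)
  ip : forall N, aform X (fun x => fib (LN N) x) ->
    aform X (fun x => fib (LN N) x) -> R[i];
  ip_inner : forall N, inner_product (cforms (LN N)) (@ip N);
  ip_0 : forall alpha beta s t, scalar_form alpha -> scalar_form beta ->
    csections (LN 0) s -> csections (LN 0) t ->
    ip (fun i K x => alpha i K x *: s x) (fun i K x => beta i K x *: t x) =
    ip0 (fun x => fpair g alpha beta x *: s x) t;
  ip_S : forall N eta theta l l', cforms (LN N) eta -> cforms (LN N) theta ->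
    csections Lb l -> csections Lb l' ->
    ip (fun i K x => LN_tens (eta i K x) (l x))
       (fun i K x => LN_tens (theta i K x) (l' x)) =
    ip (fun i K x => Lb_metric x (l x) (l' x) *: eta i K x) theta;
  (* the restriction to continuous forms of the self-adjoint projection of the
     L^2 space onto H_{N+1}, characterized by the last two fields *)
  Proj : forall N, {linear elt (cforms (LN N.+1)) ->
                           elt (holomorphic_sections (LN_nabla N.+1))};
  Proj_id : forall N s, Proj N (hol_form s) = s;
  Proj_selfadjoint : forall N eta theta,
    ip (elt_val (hol_form (Proj N eta))) (elt_val theta) =
    ip (elt_val eta) (elt_val (hol_form (Proj N theta))) }.

(* Below, the index N : nat stands for the integer N + 1 >= 1. *)
Section Toeplitz.
Variables (R : realType) (n : nat) (M : topologicalType).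
Variables (X : complex_manifold R n M) (g : kahler_metric X).
Variable (Q : quantization_data g).

Definition Hilb N := elt (holomorphic_sections (LN_nabla Q N.+1)).

Definition hnorm N (s : Hilb N) : R :=
  Num.sqrt (complex.Re (ip (elt_val (hol_form s)) (elt_val (hol_form s)))).

Definition toeplitz (f : continuous_function R M) N : {linear Hilb N -> Hilb N} :=
  Proj Q N \o mul_form f.

Definition op_seq := forall N, {linear Hilb N -> Hilb N}.

(* The c_0 direct sum of the algebras End H_N. *)
Definition alg0 (b : op_seq) := forall e : R, 0 < e -> exists N0,
  forall N (s : Hilb N), (N0 <= N)%N -> hnorm (b N s) <= e * hnorm s.

Definition alg (a : op_seq) := exists f (b : op_seq),
  alg0 b /\ forall N s, a N s = toeplitz f N s + b N s.

Section Modules.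
Variables (V : vector_bundle X) (DV : connection V).

Definition Ker N := elt (dolbeault_kernel g DV (LN_nabla Q N.+1)).
Definition hom_seq := forall N, {linear Ker N -> Hilb N}.

Definition toeplitzV (v : elt (csections V)) : hom_seq :=
  fun N => Proj Q N \o pair_form v.

Definition hom_add (x y : hom_seq) : hom_seq := fun N => x N \+ y N.
Definition hom_act (a : op_seq) (x : hom_seq) : hom_seq := fun N => a N \o x N.

(* As [alg] is a unital algebra, the module generated by the image of T^V
   consists of the finite sums of the a T^V(v) with a in [alg]. *)
Definition qmod (x : hom_seq) :=
  exists m (a : 'I_m -> op_seq) (v : 'I_m -> elt (csections V)),
    (forall l, alg (a l)) /\
    forall N psi, x N psi = \sum_l a l N (toeplitzV (v l) N psi).
End Modules.

Definition module_hom (V W : vector_bundle X) (DV : connection V)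
    (DW : connection W) (F : hom_seq DV -> hom_seq DW) :=
  [/\ forall x, qmod x -> qmod (F x),
      forall x y, qmod x -> qmod y -> F (hom_add x y) = hom_add (F x) (F y) &
      forall a x, alg a -> qmod x -> F (hom_act a x) = hom_act a (F x)].
End Toeplitz.

Record bundle_morphism (R : realType) (n : nat) (M : topologicalType)
    (X : complex_manifold R n M) (V W : vector_bundle X) (DV : connection V)
    (DW : connection W) := BundleMorphism {
  bm : sec (fun x => 'Hom(fib V x, fib W x));
  bm_smooth : smooth_hom setT bm;
  bm_parallel : forall (v : section V) i u x, smooth_sec setT v -> dom i x ->
    bm x (nabla DV i u v x) = nabla DW i u (fun y => bm y (v y)) x }.

Section Morphisms.
Variables (R : realType) (n : nat) (M : topologicalType).
Variables (X : complex_manifold R n M) (V W : vector_bundle X).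
Variables (DV : connection V) (DW : connection W).

Fact bm_section_subproof (phi : bundle_morphism DV DW) (v : elt (csections V)) :
  csections W (fun x => bm phi x (elt_val v x)).
Proof.
move=> x; apply: (cont_sec_hom openT I (bm_smooth phi)); exact: (eltP v).
Qed.
Definition bm_section phi v : elt (csections W) := Elt (bm_section_subproof phi v).
End Morphisms.

(* Main.v *)
(** The module homomorphism is precomposition with the transpose psi |-> psi o phi,
    which maps ker D_W into ker D_V because phi is covariantly constant:
    (D_V (psi o phi))(v) = (D_W psi)(phi v) for smooth sections v of V. *)

Require Import Defs.
From HB Require Import structures.
From mathcomp Require Import all_boot all_order all_algebra complex.
From mathcomp Require Import all_classical all_reals all_analysis.
Set Implicit Arguments.
Unset Strict Implicit.
Unset Printing Implicit Defensive.
Import Order.TTheory GRing.Theory Num.Theory.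
Import numFieldNormedType.Exports.
Local Open Scope classical_set_scope.
Local Open Scope ring_scope.

(** Once the underlying functions are identified, the rest of the structure consists of proofs,
    equal by proof irrelevance. This turns pointwise identities into the equalities between operator
    sequences that [module_hom] and the theorem require. *)
Lemma linear_ext (K : pzSemiRingType) (U : lSemiModType K) (U' : nmodType)
    (s : K -> U' -> U') (f h : {linear U -> U' | s}) : f =1 h -> f = h.
Proof.
case: f => f cf; case: h => h ch /= /funext fh; case: _ / fh in ch *.
case: cf ch => [[f1] [f2]] [[h1] [h2]].
by rewrite (Prop_irrelevance f1 h1) (Prop_irrelevance f2 h2).
Qed.

Section Transpose.
Variables (R : realType) (n : nat) (M : topologicalType).
Variables (X : complex_manifold R n M) (g : kahler_metric X).
Variables (V W E : vector_bundle X).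
Variables (DV : connection V) (DW : connection W) (DE : connection E).

(** The images under [A] of the frame vectors of [V] are smooth local sections of [W], and [B]
    carries smooth sections to smooth sections; this bounds the whole matrix of the composite column
    by column. *)
Lemma smooth_hom_comp O (A : sec (fun x => 'Hom(fib V x, fib W x)))
    (B : sec (fun x => 'Hom(fib W x, fib E x))) : open O ->
  smooth_hom O A -> smooth_hom O B ->
  smooth_hom O ((fun x => (B x \o A x)%VF) : sec (fun x => 'Hom(fib V x, fib E x))).
Proof.
move=> oO sA sB j l a b.
have oj : open (O `&` fr_dom (v := V) j) by apply: openI => //; exact: fr_open.
have sAj : smooth_sec (O `&` fr_dom j)
    ((fun x => A x (tnth (fr j x) a)) : section W).
  by move=> k c; rewrite -setIA; exact: sA.
have sBj : smooth_hom (O `&` fr_dom (v := V) j) B.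
  by move=> p q c d; apply: smooth_onS (sB p q c d) => y [[Oy _] ?].
have := smooth_sec_hom oj sBj sAj l b; rewrite setIA.
by under eq_fun do rewrite -comp_lfunE.
Qed.

Variable phi : bundle_morphism DV DW.

Definition transpose (psi : aform X (fun x => 'Hom(fib W x, fib E x))) :
    aform X (fun x => 'Hom(fib V x, fib E x)) :=
  fun i K x => (psi i K x \o bm phi x)%VF.

Definition bm_sec (v : section V) : section W := fun x => bm phi x (v x).

Lemma transpose_lin a psi chi :
  transpose (a *: psi + chi) = a *: transpose psi + transpose chi.
Proof.
apply/funext => i; apply/funext => K; apply: functional_extensionality_dep => x.
apply/lfunP => u.
rewrite -[LHS]/(((a *: psi i K x + chi i K x) \o bm phi x)%VF u).
rewrite -[RHS]/((a *: (psi i K x \o bm phi x) + (chi i K x \o bm phi x))%VF u).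
by rewrite !(comp_lfunE, add_lfunE, scale_lfunE).
Qed.

Lemma pairing_transpose v psi : pairing v (transpose psi) = pairing (bm_sec v) psi.
Proof.
apply/funext => i; apply/funext => K; apply: functional_extensionality_dep => x.
by rewrite /pairing /transpose comp_lfunE.
Qed.

Lemma is_form_transpose psi : is_form psi -> is_form (transpose psi).
Proof.
move=> [po pa pc]; split=> [i K x dx|i K K' k l x|i j x q K di dj].
- by rewrite /transpose po // comp_lfun0l.
- by rewrite /transpose pa comp_lfunNl.
- rewrite /transpose (pc _ _ _ _ _ di dj).
  apply/lfunP => u; rewrite comp_lfunE !sum_lfunE.
  by apply: eq_bigr => L _; rewrite !scale_lfunE comp_lfunE.
Qed.

Lemma smooth_hom_form_transpose psi :
  smooth_hom_form psi -> smooth_hom_form (transpose psi).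
Proof.
move=> sp i K; apply: smooth_hom_comp (sp i K); first exact: dom_open.
by move=> j l a b; apply: smooth_onS (bm_smooth phi j l a b) => y [_ ?].
Qed.

(** Parallelism is assumed along real directions; fibrewise complex linearity of [phi] extends it to
    the Wirtinger combinations. *)
Lemma bm_nabla10 i k v x : smooth_sec setT v -> dom i x ->
  bm phi x (nabla10 DV i k v x) = nabla10 DW i k (bm_sec v) x.
Proof.
by move=> sv dx; rewrite /nabla10 linearZ linearB linearZ /= !(bm_parallel phi).
Qed.

Lemma bm_nabla01 i k v x : smooth_sec setT v -> dom i x ->
  bm phi x (nabla01 DV i k v x) = nabla01 DW i k (bm_sec v) x.
Proof.
by move=> sv dx; rewrite /nabla01 linearZ linearD linearZ /= !(bm_parallel phi).
Qed.

(** The section [v] enters the operator only through pairings, where [phi] moves across by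
    associativity, and through its covariant derivatives, where [phi] moves across by parallelism.
    The Dirac matrices act on form indices alone. *)
Lemma dolbeault_transpose i psi v K x : smooth_sec setT v -> dom i x ->
  dolbeault g DV DE i (transpose psi) v K x =
  dolbeault g DW DE i psi (bm_sec v) K x.
Proof.
move=> sv dx.
(* All index lists [J] are needed, since [gamma10] prepends an index to [K] and [gamma01] deletes
   one. *)
have h10 k J : hom_nabla10 DV DE i k (transpose psi) v J x =
    hom_nabla10 DW DE i k psi (bm_sec v) J x.
  by rewrite /hom_nabla10 pairing_transpose comp_lfunE bm_nabla10.
have h01 m J : hom_nabla01 g DV DE i m (transpose psi) v J x =
    hom_nabla01 g DW DE i m psi (bm_sec v) J x.
  by rewrite /hom_nabla01 pairing_transpose comp_lfunE bm_nabla01.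
rewrite /dolbeault; congr (_ *: (_ + _)); apply: eq_bigr => k _.
  by rewrite /gamma10; under eq_bigr do rewrite h10.
by rewrite /gamma01; under eq_bigr do rewrite h01.
Qed.

Lemma transpose_kernel psi :
  dolbeault_kernel g DW DE psi -> dolbeault_kernel g DV DE (transpose psi).
Proof.
move=> [fp sp dp]; split; first exact: is_form_transpose.
  exact: smooth_hom_form_transpose.
(* The kernel condition on [psi] is tested on the section [bm_sec v] of [W], which is smooth because
   [phi] is. *)
move=> v i K x sv dx; rewrite dolbeault_transpose //; apply: dp => //.
by apply: smooth_sec_hom sv; [exact: openT|exact: bm_smooth].
Qed.

Definition ker_transpose (psi : elt (dolbeault_kernel g DW DE)) :
    elt (dolbeault_kernel g DV DE) := Elt (transpose_kernel (eltP psi)).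

Fact ker_transpose_linear : linear ker_transpose.
Proof.
move=> a s t; apply/val_inj.
have e : elt_val (a *: s + t) = a *: elt_val s + elt_val t by [].
by rewrite -[LHS]/(transpose (elt_val (a *: s + t))) e transpose_lin.
Qed.
HB.instance Definition _ := GRing.isLinear.Build R[i]
  (elt (dolbeault_kernel g DW DE)) (elt (dolbeault_kernel g DV DE)) *:%R
  ker_transpose ker_transpose_linear.

(** Associativity of evaluation; both the intertwining relation and the stability of the quantized
    modules come from it after projecting. *)
Lemma pair_form_transpose (v : elt (csections V))
    (psi : elt (dolbeault_kernel g DW DE)) :
  pair_form v (ker_transpose psi) = pair_form (bm_section phi v) psi.
Proof. by apply/val_inj; exact: pairing_transpose. Qed.
End Transpose.

Section InducedMap.
Variables (R : realType) (n : nat) (M : topologicalType).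
Variables (X : complex_manifold R n M) (g : kahler_metric X).
Variables (Q : quantization_data g) (V W : vector_bundle X).
Variables (DV : connection V) (DW : connection W) (phi : bundle_morphism DV DW).

(** Precomposition makes sense on the full product of Hom spaces; that it maps one quantized module
    into the other is part of [module_hom]. *)
Definition quantized_morphism (x : hom_seq Q DV) : hom_seq Q DW := fun N =>
  x N \o @ker_transpose _ _ _ _ g _ _ _ _ _ (LN_nabla Q N.+1) phi.

Lemma hom_seq_ext (x y : hom_seq Q DW) : (forall N, x N =1 y N) -> x = y.
Proof.
by move=> xy; apply: functional_extensionality_dep => N; exact: linear_ext.
Qed.

Lemma toeplitzV_bm_section v :
  toeplitzV Q DW (bm_section phi v) = quantized_morphism (toeplitzV Q DV v).
Proof. by apply: hom_seq_ext => N psi; rewrite /= pair_form_transpose. Qed.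

(** The algebra acts by postcomposition, which commutes with precomposition, and addition is
    pointwise; only the stability of the modules takes an argument. *)
Lemma quantized_morphism_hom : module_hom quantized_morphism.
Proof.
split=> [x [m [a [v [aa xE]]]]|x y _ _|a x _ _].
(* The coefficients in the algebra stay the same, and each generator $T^V(v_l)$ becomes
   $T^W(\phi(v_l))$. *)
- exists m, a, (fun l => bm_section phi (v l)); split=> // N psi.
  by rewrite /= xE; apply: eq_bigr => l _; rewrite /= pair_form_transpose.
- exact: hom_seq_ext.
- exact: hom_seq_ext.
Qed.
End InducedMap.

Theorem mainTheorem2 (R : realType) (n : nat) (M : topologicalType)
    (M_hausdorff : hausdorff_space M) (M_compact : compact [set: M])
    (M_connected : connected [set: M]) (X : complex_manifold R n M)
    (g : kahler_metric X) (Q : quantization_data g)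
    (V W : vector_bundle X) (DV : connection V) (DW : connection W)
    (phi : bundle_morphism DV DW) :
  exists Qphi : hom_seq Q DV -> hom_seq Q DW, module_hom Qphi /\
    forall v : elt (csections V),
      toeplitzV Q DW (bm_section phi v) = Qphi (toeplitzV Q DV v).
Proof.
exists (quantized_morphism (Q := Q) phi); split; first exact: quantized_morphism_hom.
exact: toeplitzV_bm_section.
Qed.
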